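(* Let $\mathbf C=(\mathbf C,\otimes,I)$ be a symmetric (strict) monoidal category and let $\mathbf P\subset\mathbf C$ be a full subcategory. (a) Suppose $\mathbf C$ is closed relative to $\mathbf P$ and let $\mathbb M=(X,\mu_X,\eta_X)$ be a monoid in $\mathbf C$. For any $V\in\mathbf P$ the bijection $$\theta_{X,V,V}\colon\mathrm{Hom}\big(X,\mathbf{end}(V)\big)\to\mathrm{Hom}(X\otimes V,V)$$ establishes a one-to-one correspondence between representations $\rho\colon\mathbb M\to\mathbf{end}(V)$ of $\mathbb M$ on $V$ and (left) actions $a\colon X\otimes V\to V$ of $\mathbb M$ on $V$; that is, $\rho\in\mathrm{Hom}(X,\mathbf{end}(V))$ is a representation if and only if $a=\theta(\rho)$ is an action. For $(V,\rho),(W,\tau)\in\mathrm{Rep}_{\mathbf P}(\mathbb M)$, a morphism $f\colon V\to W$ is a morphism of representations $(V,\rho)\to(W,\tau)$ if and only if it is a morphism of actions $(V,a)\to(W,b)$, where $a=\theta(\rho)$, $b=\theta(\tau)$. Hence $(V,\rho)\mapsto(V,\theta(\rho))$ (and $f\mapsto f$) defines a fully faithful functor $\mathrm{Rep}_{\mathbf P}(\mathbb M)\hookrightarrow\mathrm{Lact}(\mathbb M)$. (b) Suppose $\mathbf C$ is coclosed relative to $\mathbf P$ and let $\mathbb O=(X,\Delta_X,\varepsilon_X)$ be a comonoid in $\mathbf C$. Then the bijections $\vartheta_{V,V,X}\colon\mathrm{Hom}(\mathbf{coend}(V),X)\cong\mathrm{Hom}(V,X\otimes V)$, $V\in\mathbf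 P$, give a fully faithful functor $\mathrm{Corep}_{\mathbf P}(\mathbb O)\hookrightarrow\mathrm{Lcoact}(\mathbb O)$, $(V,\omega)\mapsto(V,\vartheta(\omega))$. (c) If $\mathbf C$ is closed, respectively coclosed (i.e. $\mathbf P=\mathbf C$), then the functor of (a), respectively of (b), is an equivalence (more exactly, an isomorphism) of categories.
   Context: Monoidal categories are strict; $f\cdot g$ denotes composition ($g$ first). Relatively closed: $\mathbf C$ is closed relative to $\mathbf P$ if there are a bifunctor $\mathbf{hom}\colon\mathbf P^{op}\times\mathbf P\to\mathbf C$ and bijections $\theta_{X,V,W}\colon\mathrm{Hom}(X,\mathbf{hom}(V,W))\to\mathrm{Hom}(X\otimes V,W)$ natural in $X\in\mathbf C$, $V,W\in\mathbf P$. Put $\mathrm{ev}_{V,W}=\theta(\mathrm{id}_{\mathbf{hom}(V,W)})\colon\mathbf{hom}(V,W)\otimes V\to W$. For $V\in\mathbf P$, $\mathbf{end}(V)=\mathbf{hom}(V,V)$ is a monoid in $\mathbf C$ with multiplication $c_V=\theta^{-1}\big(\mathrm{ev}_{V,V}\cdot(\mathrm{id}\otimes\mathrm{ev}_{V,V})\big)\colon\mathbf{end}(V)\otimes\mathbf{end}(V)\to\mathbf{end}(V)$ and unit $u_V=\theta^{-1}(\mathrm{id}_V)\colon I\to\mathbf{end}(V)$. Relatively coclosed: $\mathbf C$ is coclosed relative to $\mathbf P$ if there are a bifunctor $\mathbf{cohom}\colon\mathbf P^{op}\times\mathbf P\to\mathbf C$ and bijections $\vartheta_{W,V,Z}\colon\mathrm{Hom}(\mathbf{cohom}(V,W),Z)\to\mathrm{Hom}(W,Z\otimes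 V)$ natural in $V,W\in\mathbf P$, $Z\in\mathbf C$. Put $\mathrm{coev}_{V,W}=\vartheta(\mathrm{id})\colon W\to\mathbf{cohom}(V,W)\otimes V$. For $V\in\mathbf P$, $\mathbf{coend}(V)=\mathbf{cohom}(V,V)$ is a comonoid with comultiplication $d_V=\vartheta^{-1}\big((\mathrm{id}\otimes\mathrm{coev}_{V,V})\cdot\mathrm{coev}_{V,V}\big)$ and counit $v_V=\vartheta^{-1}(\mathrm{id}_V)\colon\mathbf{coend}(V)\to I$. A representation of $\mathbb M$ on $V\in\mathbf P$ is a morphism of monoids $\rho\colon\mathbb M\to\mathbf{end}(V)$. $\mathrm{Rep}_{\mathbf P}(\mathbb M)$ has objects $(V,\rho)$; morphisms $(V,\rho)\to(W,\tau)$ are morphisms $f\colon V\to W$ in $\mathbf P$ with $\mathbf{hom}(\mathrm{id}_V,f)\cdot\rho=\mathbf{hom}(f,\mathrm{id}_W)\cdot\tau$ as morphisms $X\to\mathbf{hom}(V,W)$. A corepresentation of $\mathbb O$ on $V\in\mathbf P$ is a morphism of comonoids $\omega\colon\mathbf{coend}(V)\to\mathbb O$. $\mathrm{Corep}_{\mathbf P}(\mathbb O)$ has objects $(V,\omega)$; morphisms $(V,\omega)\to(W,\nu)$ are morphisms $f\colon V\to W$ in $\mathbf P$ with $\omega\cdot\mathbf{cohom}(f,\mathrm{id}_V)=\nu\cdot\mathbf{cohom}(\mathrm{id}_W,f)$ as morphisms $\mathbf{cohom}(W,V)\to X$. $\mathrm{Lact}(\mathbb M)$ is the category of pairs $(V,a)$,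 $V\in\mathbf C$, $a\colon X\otimes V\to V$ a left action of $\mathbb M$, with morphisms commuting with actions; $\mathrm{Lcoact}(\mathbb O)$ is the category of pairs $(V,\delta)$, $V\in\mathbf C$, $\delta\colon V\to X\otimes V$ a left coaction of $\mathbb O$, with morphisms commuting with coactions. *)

(* Defs.v *)
From Corelib Require Import ssreflect ssrfun.
From Stdlib Require Import ProofIrrelevance.

Set Implicit Arguments.
Unset Strict Implicit.
Unset Printing Implicit Defensive.

#[local] Obligation Tactic := idtac.

Declare Scope cat_scope.
Delimit Scope cat_scope with cat.
Open Scope cat_scope.

Record category := Category {
  Ob :> Type;
  Hom : Ob -> Ob -> Type;
  idm : forall A, Hom A A;
  comp : forall A B D, Hom B D -> Hom A B -> Hom A D;
  comp1m : forall A B (f : Hom A B), comp (idm B) f = f;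
  compm1 : forall A B (f : Hom A B), comp f (idm A) = f;
  compA : forall A B D E (h : Hom D E) (g : Hom B D) (f : Hom A B),
    comp h (comp g f) = comp (comp h g) f
}.
Arguments Hom {c} A B.
Arguments idm {c} A.
Arguments comp {c A B D} f g.

Notation "f ∘ g" := (comp f g) (at level 40, left associativity) : cat_scope.

Program Definition op_cat (C : category) : category :=
  @Category C (fun A B => @Hom C B A) (@idm C) (fun A B D g f => f ∘ g) _ _ _.
Next Obligation. by move=> C A B f /=; rewrite compm1. Qed.
Next Obligation. by move=> C A B f /=; rewrite comp1m. Qed.
Next Obligation. by move=> C A B D E h g f /=; rewrite compA. Qed.

Program Definition prod_cat (C D : category) : category :=
  @Category (C * D)%type
    (fun A B => (Hom (fst A) (fst B) * Hom (snd A) (snd B))%type)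
    (fun A => (idm (fst A), idm (snd A)))
    (fun A B E g f => (fst g ∘ fst f, snd g ∘ snd f)) _ _ _.
Next Obligation. by move=> C D A B [f g] /=; rewrite !comp1m. Qed.
Next Obligation. by move=> C D A B [f g] /=; rewrite !compm1. Qed.
Next Obligation. by move=> C D A B E F h g f /=; rewrite !compA. Qed.

(* The full subcategory on the objects satisfying [P]. *)
Program Definition full_sub (C : category) (P : C -> Prop) : category :=
  @Category {V : C | P V} (fun V W => Hom (proj1_sig V) (proj1_sig W))
    (fun V => idm (proj1_sig V)) (fun _ _ _ g f => g ∘ f) _ _ _.
Next Obligation. by move=> C P V W f /=; rewrite comp1m. Qed.
Next Obligation. by move=> C P V W f /=; rewrite compm1. Qed.
Next Obligation. by move=> C P V W Z T h g f /=; rewrite compA. Qed.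

Definition incl (C : category) (P : C -> Prop) (V : full_sub P) : C :=
  proj1_sig V.

Record functor (C D : category) := Functor {
  fob :> C -> D;
  fmap : forall A B, Hom A B -> Hom (fob A) (fob B);
  fmap1 : forall A, fmap (idm A) = idm (fob A);
  fmapM : forall A B E (g : Hom B E) (f : Hom A B),
    fmap (g ∘ f) = fmap g ∘ fmap f
}.

Program Definition id_functor (C : category) : functor C C :=
  @Functor C C (fun A => A) (fun _ _ f => f) _ _.
Next Obligation. by []. Qed.
Next Obligation. by []. Qed.

Program Definition comp_functor (C D E : category) (G : functor D E)
    (F : functor C D) : functor C E :=
  @Functor C E (fun A => G (F A)) (fun _ _ f => fmap G (fmap F f)) _ _.
Next Obligation. by move=> C D E G F A; rewrite /= !fmap1. Qed.
Next Obligation. by move=> C D E G F A B A' g f /=; rewrite !fmapM. Qed.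

Definition fully_faithful (C D : category) (F : functor C D) : Prop :=
  forall A B : C, bijective (@fmap C D F A B).

Definition naturally_isomorphic (C D : category) (F G : functor C D) : Prop :=
  exists (s : forall A : C, Hom (F A) (G A)) (t : forall A : C, Hom (G A) (F A)),
    (forall A, t A ∘ s A = idm (F A) /\ s A ∘ t A = idm (G A)) /\
    (forall A B (f : Hom A B), s B ∘ fmap F f = fmap G f ∘ s A).

Definition is_equivalence (C D : category) (F : functor C D) : Prop :=
  exists G : functor D C,
    naturally_isomorphic (comp_functor G F) (id_functor C) /\
    naturally_isomorphic (comp_functor F G) (id_functor D).

Definition is_isomorphism (C D : category) (F : functor C D) : Prop :=
  exists G : functor D C,
    comp_functor G F = id_functor C /\ comp_functor F G = id_functor D.

(* An equality of objects seen as a morphism.  Strictness of a monoidal category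
   is an equality of objects, which is not a conversion; the identity morphisms
   that it provides (and that are silent on paper) are written [eqmor]. *)
Definition eqmor (C : category) (A B : C) (e : A = B) : Hom A B :=
  match e in _ = B' return Hom A B' with eq_refl => idm A end.

Definition tensor0 (C : category) (T : functor (prod_cat C C) C) (A B : C) : C :=
  T (A, B).

Definition tensor1 (C : category) (T : functor (prod_cat C C) C)
    (A A' B B' : C) (f : Hom A A') (g : Hom B B') :
    Hom (tensor0 T A B) (tensor0 T A' B') :=
  @fmap _ _ T (A, B) (A', B') (f, g).

(* The last three axioms say that (f ⊗ g) ⊗ h = f ⊗ (g ⊗ h), id_I ⊗ f = f and
   f ⊗ id_I = f, along the equalities between their sources and targets. *)
Record strict_monoidal := StrictMonoidal {
  mcat :> category;
  tens : functor (prod_cat mcat mcat) mcat;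
  munit : mcat;
  tensA : forall A B D : mcat,
    tensor0 tens (tensor0 tens A B) D = tensor0 tens A (tensor0 tens B D);
  tens1o : forall A : mcat, tensor0 tens munit A = A;
  tenso1 : forall A : mcat, tensor0 tens A munit = A;
  tensA_mor : forall (A A' B B' D D' : mcat)
      (f : Hom A A') (g : Hom B B') (h : Hom D D'),
    eqmor (tensA A' B' D') ∘ tensor1 tens (tensor1 tens f g) h =
    tensor1 tens f (tensor1 tens g h) ∘ eqmor (tensA A B D);
  tens1o_mor : forall (A A' : mcat) (f : Hom A A'),
    eqmor (tens1o A') ∘ tensor1 tens (idm munit) f = f ∘ eqmor (tens1o A);
  tenso1_mor : forall (A A' : mcat) (f : Hom A A'),
    eqmor (tenso1 A') ∘ tensor1 tens f (idm munit) = f ∘ eqmor (tenso1 A)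
}.
Arguments munit {s}.

Notation "A ⊗ B" := (tensor0 (tens _) A B)
  (at level 35, no associativity) : cat_scope.
Notation "f ⊠ g" := (tensor1 (tens _) f g)
  (at level 35, no associativity) : cat_scope.

Definition asc (C : strict_monoidal) (A B D : C) :
  Hom ((A ⊗ B) ⊗ D) (A ⊗ (B ⊗ D)) := eqmor (tensA A B D).
Definition ascV (C : strict_monoidal) (A B D : C) :
  Hom (A ⊗ (B ⊗ D)) ((A ⊗ B) ⊗ D) := eqmor (eq_sym (tensA A B D)).
Definition lun (C : strict_monoidal) (A : C) : Hom (munit ⊗ A) A :=
  eqmor (tens1o A).
Definition lunV (C : strict_monoidal) (A : C) : Hom A (munit ⊗ A) :=
  eqmor (eq_sym (tens1o A)).
Definition run (C : strict_monoidal) (A : C) : Hom (A ⊗ munit) A :=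
  eqmor (tenso1 A).

Record symmetric_monoidal := SymmetricMonoidal {
  scat :> strict_monoidal;
  braid : forall A B : scat, Hom (A ⊗ B) (B ⊗ A);
  braid_nat : forall (A A' B B' : scat) (f : Hom A A') (g : Hom B B'),
    braid A' B' ∘ (f ⊠ g) = (g ⊠ f) ∘ braid A B;
  braidK : forall A B : scat, braid B A ∘ braid A B = idm (A ⊗ B);
  braid_hexagon : forall A B D : scat,
    asc B D A ∘ braid A (B ⊗ D) ∘ asc A B D =
    (idm B ⊠ braid A D) ∘ asc B A D ∘ (braid A B ⊠ idm D)
}.

Section EqmorTheory.
Variable C : strict_monoidal.
Implicit Types A B D E : C.

Lemma tens1 A B : idm A ⊠ idm B = idm (A ⊗ B).
Proof. exact: (@fmap1 _ _ (tens C) (A, B)). Qed.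

Lemma tensM A A' A'' B B' B'' (f' : Hom A' A'') (f : Hom A A')
    (g' : Hom B' B'') (g : Hom B B') :
  (f' ∘ f) ⊠ (g' ∘ g) = (f' ⊠ g') ∘ (f ⊠ g).
Proof.
exact: (@fmapM _ _ (tens C) (A, B) (A', B') (A'', B'') (f', g') (f, g)).
Qed.

Lemma tens_lr A A' B B' (f : Hom A A') (g : Hom B B') :
  f ⊠ g = (f ⊠ idm B') ∘ (idm A ⊠ g).
Proof. by rewrite -tensM comp1m compm1. Qed.

Lemma tens_rl A A' B B' (f : Hom A A') (g : Hom B B') :
  f ⊠ g = (idm A' ⊠ g) ∘ (f ⊠ idm B).
Proof. by rewrite -tensM comp1m compm1. Qed.

Lemma tens1M A B B' B'' (g' : Hom B' B'') (g : Hom B B') :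
  idm A ⊠ (g' ∘ g) = (idm A ⊠ g') ∘ (idm A ⊠ g).
Proof. by rewrite -tensM comp1m. Qed.

Lemma eqmorM A B D (e : A = B) (e' : B = D) :
  eqmor e' ∘ eqmor e = eqmor (eq_trans e e').
Proof. by case: _ / e'; rewrite comp1m. Qed.

Lemma eqmor_tensl A B D (e : A = B) :
  eqmor e ⊠ idm D = eqmor (f_equal (fun Z => Z ⊗ D) e).
Proof. by case: _ / e; rewrite tens1. Qed.

Lemma eqmor_tensr A B D (e : A = B) :
  idm D ⊠ eqmor e = eqmor (f_equal (fun Z => D ⊗ Z) e).
Proof. by case: _ / e; rewrite tens1. Qed.

Lemma eqmor_irr A B (e e' : A = B) : eqmor e = eqmor e'.
Proof. by rewrite (proof_irrelevance _ e e'). Qed.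

Lemma ascK A B D : ascV A B D ∘ asc A B D = idm _.
Proof. by rewrite /asc /ascV eqmorM (eqmor_irr _ eq_refl). Qed.

Lemma ascVK A B D : asc A B D ∘ ascV A B D = idm _.
Proof. by rewrite /asc /ascV eqmorM (eqmor_irr _ eq_refl). Qed.

Lemma lunK A : lunV A ∘ lun A = idm _.
Proof. by rewrite /lun /lunV eqmorM (eqmor_irr _ eq_refl). Qed.

Lemma lunVK A : lun A ∘ lunV A = idm _.
Proof. by rewrite /lun /lunV eqmorM (eqmor_irr _ eq_refl). Qed.

Lemma asc_nat A A' B B' D D' (f : Hom A A') (g : Hom B B') (h : Hom D D') :
  asc A' B' D' ∘ ((f ⊠ g) ⊠ h) = (f ⊠ (g ⊠ h)) ∘ asc A B D.
Proof. exact: tensA_mor. Qed.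

Lemma ascV_nat A A' B B' D D' (f : Hom A A') (g : Hom B B') (h : Hom D D') :
  ascV A' B' D' ∘ (f ⊠ (g ⊠ h)) = ((f ⊠ g) ⊠ h) ∘ ascV A B D.
Proof.
rewrite -[LHS]compm1 -(ascVK A B D) -!compA (compA (_ ⊠ (_ ⊠ _))).
by rewrite -asc_nat -!compA compA ascK comp1m.
Qed.

Lemma lun_nat A A' (f : Hom A A') : lun A' ∘ (idm munit ⊠ f) = f ∘ lun A.
Proof. exact: tens1o_mor. Qed.

Lemma lunV_nat A A' (f : Hom A A') : lunV A' ∘ f = (idm munit ⊠ f) ∘ lunV A.
Proof.
rewrite -[LHS]compm1 -(lunVK A) -!compA (compA f).
by rewrite -lun_nat -!compA compA lunK comp1m.
Qed.

Lemma asc_pentagon A B D E :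
  asc A B (D ⊗ E) ∘ asc (A ⊗ B) D E =
  (idm A ⊠ asc B D E) ∘ asc A (B ⊗ D) E ∘ (asc A B D ⊠ idm E).
Proof. rewrite /asc eqmor_tensl eqmor_tensr !eqmorM; exact: eqmor_irr. Qed.

Lemma ascV_pentagon A B D E :
  ascV (A ⊗ B) D E ∘ ascV A B (D ⊗ E) =
  (ascV A B D ⊠ idm E) ∘ ascV A (B ⊗ D) E ∘ (idm A ⊠ ascV B D E).
Proof. rewrite /ascV eqmor_tensl eqmor_tensr !eqmorM; exact: eqmor_irr. Qed.

Lemma lun_asc A B : lun (A ⊗ B) ∘ asc munit A B = lun A ⊠ idm B.
Proof. rewrite /asc /lun eqmor_tensl !eqmorM; exact: eqmor_irr. Qed.

Lemma run_asc A B : (idm A ⊠ lun B) ∘ asc A munit B = run A ⊠ idm B.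
Proof. rewrite /asc /lun /run eqmor_tensl eqmor_tensr !eqmorM; exact: eqmor_irr. Qed.

Lemma lun_ascV A B : (lun A ⊠ idm B) ∘ ascV munit A B = lun (A ⊗ B).
Proof. by rewrite -lun_asc -compA ascVK compm1. Qed.

Lemma run_ascV A B : (run A ⊠ idm B) ∘ ascV A munit B = idm A ⊠ lun B.
Proof. by rewrite -run_asc -compA ascVK compm1. Qed.

Lemma assoc_of_ev (E v : C) (c : Hom (E ⊗ E) E) (e : Hom (E ⊗ v) v) :
  e ∘ (c ⊠ idm v) = e ∘ (idm E ⊠ e) ∘ asc E E v ->
  e ∘ (c ⊠ idm v) ∘ ((c ⊠ idm E) ⊠ idm v) =
  e ∘ (c ⊠ idm v) ∘ ((idm E ⊠ c) ⊠ idm v) ∘ (asc E E E ⊠ idm v).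
Proof.
move=> cE; rewrite cE.
have -> : e ∘ (idm E ⊠ e) ∘ asc E E v ∘ ((c ⊠ idm E) ⊠ idm v) =
    e ∘ (idm E ⊠ (e ∘ (idm E ⊠ e))) ∘ (asc E E (E ⊗ v) ∘ asc (E ⊗ E) E v).
  rewrite -!compA asc_nat tens1.
  rewrite (compA (idm E ⊠ e)) -tens_rl (tens_lr c e) -!compA (compA e) cE.
  by rewrite -(tens1 E E) -!compA (compA (asc E E v)) asc_nat tens1M -!compA.
have -> : e ∘ (idm E ⊠ e) ∘ asc E E v ∘ ((idm E ⊠ c) ⊠ idm v) =
    e ∘ (idm E ⊠ (e ∘ (idm E ⊠ e))) ∘ ((idm E ⊠ asc E E v) ∘ asc E (E ⊗ E) v).
  rewrite -!compA asc_nat.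
  by rewrite (compA (idm E ⊠ e)) -tens1M cE !tens1M -!compA.
by rewrite asc_pentagon !compA.
Qed.

Lemma coassoc_of_coev (E v : C) (d : Hom E (E ⊗ E)) (e : Hom v (E ⊗ v)) :
  (d ⊠ idm v) ∘ e = ascV E E v ∘ (idm E ⊠ e) ∘ e ->
  ((d ⊠ idm E) ⊠ idm v) ∘ ((d ⊠ idm v) ∘ e) =
  (ascV E E E ⊠ idm v) ∘ (((idm E ⊠ d) ⊠ idm v) ∘ ((d ⊠ idm v) ∘ e)).
Proof.
move=> dE; rewrite dE.
have -> : ((d ⊠ idm E) ⊠ idm v) ∘ (ascV E E v ∘ (idm E ⊠ e) ∘ e) =
    ascV (E ⊗ E) E v ∘ ascV E E (E ⊗ v) ∘ ((idm E ⊠ ((idm E ⊠ e) ∘ e)) ∘ e).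
  rewrite !compA -ascV_nat tens1 -!compA.
  rewrite (compA (d ⊠ _)) -tens_lr (tens_rl d e) -!compA dE.
  by rewrite -(tens1 E E) -!compA (compA _ (ascV E E v)) -ascV_nat tens1M -!compA.
have -> : ((idm E ⊠ d) ⊠ idm v) ∘ (ascV E E v ∘ (idm E ⊠ e) ∘ e) =
    ascV E (E ⊗ E) v ∘ (idm E ⊠ ascV E E v)
      ∘ ((idm E ⊠ ((idm E ⊠ e) ∘ e)) ∘ e).
  rewrite !compA -ascV_nat -!compA.
  by rewrite (compA (idm E ⊠ (d ⊠ _))) -tens1M dE !tens1M -!compA.
by rewrite ascV_pentagon !compA.
Qed.

Lemma counitl_of_coev (E v : C) (d : Hom E (E ⊗ E)) (u : Hom E munit)
    (e : Hom v (E ⊗ v)) :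
  (d ⊠ idm v) ∘ e = ascV E E v ∘ (idm E ⊠ e) ∘ e ->
  (u ⊠ idm v) ∘ e = lunV v ->
  (lun E ⊠ idm v) ∘ (((u ⊠ idm E) ⊠ idm v) ∘ ((d ⊠ idm v) ∘ e)) = e.
Proof.
move=> -> uE; rewrite -!compA (compA _ (ascV E E v)) -ascV_nat tens1 -!compA.
rewrite (compA (u ⊠ _)) -tens_lr (tens_rl u e) -!compA uE -lunV_nat.
by rewrite compA lun_ascV compA lunVK comp1m.
Qed.

Lemma counitr_of_coev (E v : C) (d : Hom E (E ⊗ E)) (u : Hom E munit)
    (e : Hom v (E ⊗ v)) :
  (d ⊠ idm v) ∘ e = ascV E E v ∘ (idm E ⊠ e) ∘ e ->
  (u ⊠ idm v) ∘ e = lunV v ->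
  (run E ⊠ idm v) ∘ (((idm E ⊠ u) ⊠ idm v) ∘ ((d ⊠ idm v) ∘ e)) = e.
Proof.
move=> -> uE; rewrite -!compA (compA _ (ascV E E v)) -ascV_nat -!compA.
rewrite (compA (idm E ⊠ _)) -tens1M uE.
by rewrite compA run_ascV compA -tens1M lunVK tens1 comp1m.
Qed.

End EqmorTheory.

Record monoid (C : strict_monoidal) := Monoid {
  mon_ob :> C;
  mon_mul : Hom (mon_ob ⊗ mon_ob) mon_ob;
  mon_one : Hom munit mon_ob;
  mon_mulA : mon_mul ∘ (mon_mul ⊠ idm mon_ob) =
    mon_mul ∘ (idm mon_ob ⊠ mon_mul) ∘ asc mon_ob mon_ob mon_ob;
  mon_mul1l : mon_mul ∘ (mon_one ⊠ idm mon_ob) = lun mon_ob;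
  mon_mul1r : mon_mul ∘ (idm mon_ob ⊠ mon_one) = run mon_ob
}.
Arguments mon_mul {C} m.
Arguments mon_one {C} m.

Definition is_monoid_mor (C : strict_monoidal) (M N : monoid C) (f : Hom M N) :
    Prop :=
  f ∘ mon_mul M = mon_mul N ∘ (f ⊠ f) /\ f ∘ mon_one M = mon_one N.

Record comonoid (C : strict_monoidal) := Comonoid {
  com_ob :> C;
  com_mul : Hom com_ob (com_ob ⊗ com_ob);
  com_one : Hom com_ob munit;
  com_mulA : asc com_ob com_ob com_ob ∘ (com_mul ⊠ idm com_ob) ∘ com_mul =
    (idm com_ob ⊠ com_mul) ∘ com_mul;
  com_mul1l : lun com_ob ∘ (com_one ⊠ idm com_ob) ∘ com_mul = idm com_ob;
  com_mul1r : run com_ob ∘ (idm com_ob ⊠ com_one) ∘ com_mul = idm com_ob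
}.
Arguments com_mul {C} c.
Arguments com_one {C} c.

Definition is_comonoid_mor (C : strict_monoidal) (M N : comonoid C)
    (f : Hom M N) : Prop :=
  com_mul N ∘ f = (f ⊠ f) ∘ com_mul M /\ com_one N ∘ f = com_one M.

Definition bifun0 (C : category) (P : C -> Prop)
    (H : functor (prod_cat (op_cat (full_sub P)) (full_sub P)) C)
    (V W : full_sub P) : C := H (V, W).

Definition bifun1 (C : category) (P : C -> Prop)
    (H : functor (prod_cat (op_cat (full_sub P)) (full_sub P)) C)
    (V V' W W' : full_sub P) (v : Hom V' V) (w : Hom W W') :
    Hom (bifun0 H V W) (bifun0 H V' W') :=
  @fmap _ _ H (V, W) (V', W') (v, w).

Lemma bifunM (C : category) (P : C -> Prop)
    (H : functor (prod_cat (op_cat (full_sub P)) (full_sub P)) C)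
    (V V' V'' W W' W'' : full_sub P) (v' : Hom V'' V') (v : Hom V' V)
    (w' : Hom W' W'') (w : Hom W W') :
  bifun1 H v' w' ∘ bifun1 H v w = bifun1 H (v ∘ v') (w' ∘ w).
Proof.
symmetry; exact: (@fmapM _ _ H (V, W) (V', W') (V'', W'') (v', w') (v, w)).
Qed.

Section BifunTheory.
Variables (C : category) (P : C -> Prop).
Variable H : functor (prod_cat (op_cat (full_sub P)) (full_sub P)) C.

Lemma bifunMr (V W W' W'' : full_sub P) (w' : Hom W' W'') (w : Hom W W') :
  bifun1 H (idm V) (w' ∘ w) = bifun1 H (idm V) w' ∘ bifun1 H (idm V) w.
Proof. by rewrite bifunM (comp1m (idm V : @Hom (full_sub P) V V)). Qed.

Lemma bifunMl (W V V' V'' : full_sub P) (v' : Hom V'' V') (v : Hom V' V) :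
  bifun1 H (v ∘ v') (idm W) = bifun1 H v' (idm W) ∘ bifun1 H v (idm W).
Proof. by rewrite bifunM (comp1m (idm W : @Hom (full_sub P) W W)). Qed.

Lemma bifunC (V V' W W' : full_sub P) (v : Hom V' V) (w : Hom W W') :
  bifun1 H (idm V') w ∘ bifun1 H v (idm W) =
  bifun1 H v (idm W') ∘ bifun1 H (idm V) w.
Proof.
rewrite !bifunM (comp1m (v : @Hom (full_sub P) V' V)) (compm1 v).
by rewrite (comp1m (w : @Hom (full_sub P) W W')) (compm1 w).
Qed.

End BifunTheory.

Record rel_closed (C : strict_monoidal) (P : C -> Prop) := RelClosed {
  ihom : functor (prod_cat (op_cat (full_sub P)) (full_sub P)) C;
  theta : forall (X : C) (V W : full_sub P),
    Hom X (bifun0 ihom V W) -> Hom (X ⊗ incl V) (incl W);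
  thetaV : forall (X : C) (V W : full_sub P),
    Hom (X ⊗ incl V) (incl W) -> Hom X (bifun0 ihom V W);
  thetaK : forall X V W, cancel (@theta X V W) (@thetaV X V W);
  thetaVK : forall X V W, cancel (@thetaV X V W) (@theta X V W);
  theta_nat : forall (X X' : C) (V V' W W' : full_sub P) (x : Hom X' X)
      (v : Hom V' V) (w : Hom W W') (phi : Hom X (bifun0 ihom V W)),
    theta (bifun1 ihom v w ∘ phi ∘ x) =
    (w : Hom (incl W) (incl W')) ∘ theta phi
      ∘ (x ⊠ (v : Hom (incl V') (incl V)))
}.

Record rel_coclosed (C : strict_monoidal) (P : C -> Prop) := RelCoclosed {
  cohom : functor (prod_cat (op_cat (full_sub P)) (full_sub P)) C;
  vtheta : forall (W V : full_sub P) (Z : C),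
    Hom (bifun0 cohom V W) Z -> Hom (incl W) (Z ⊗ incl V);
  vthetaV : forall (W V : full_sub P) (Z : C),
    Hom (incl W) (Z ⊗ incl V) -> Hom (bifun0 cohom V W) Z;
  vthetaK : forall W V Z, cancel (@vtheta W V Z) (@vthetaV W V Z);
  vthetaVK : forall W V Z, cancel (@vthetaV W V Z) (@vtheta W V Z);
  vtheta_nat : forall (Z Z' : C) (V V' W W' : full_sub P) (z : Hom Z Z')
      (v : Hom V V') (w : Hom W' W) (phi : Hom (bifun0 cohom V W) Z),
    vtheta (z ∘ phi ∘ bifun1 cohom v w) =
    (z ⊠ (v : Hom (incl V) (incl V'))) ∘ vtheta phi
      ∘ (w : Hom (incl W') (incl W))
}.

Arguments theta {C P} r {X V W} _.
Arguments thetaV {C P} r {X V W} _.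
Arguments vtheta {C P} r {W V Z} _.
Arguments vthetaV {C P} r {W V Z} _.

Section Closed.
Variables (C : strict_monoidal) (P : C -> Prop) (H : rel_closed P).

Definition ev (V W : full_sub P) :
    Hom (bifun0 (ihom H) V W ⊗ incl V) (incl W) :=
  theta H (idm (bifun0 (ihom H) V W)).

Definition end_ob (V : full_sub P) : C := bifun0 (ihom H) V V.

Definition end_mul (V : full_sub P) : Hom (end_ob V ⊗ end_ob V) (end_ob V) :=
  thetaV H (ev V V ∘ (idm (end_ob V) ⊠ ev V V) ∘ asc _ _ _).

Definition end_one (V : full_sub P) : Hom munit (end_ob V) :=
  thetaV H (lun (incl V)).

Lemma thetaE X (V W : full_sub P) (phi : Hom X (bifun0 (ihom H) V W)) :
  theta H phi = ev V W ∘ (phi ⊠ idm (incl V)).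
Proof.
have E : bifun1 (ihom H) (idm V) (idm W) = idm _ by exact: fmap1.
have : theta H (bifun1 (ihom H) (idm V) (idm W) ∘ idm _ ∘ phi) =
    idm (incl W) ∘ ev V W ∘ (phi ⊠ idm (incl V)) by exact: theta_nat.
by rewrite E !comp1m.
Qed.

Lemma theta_inj X (V W : full_sub P) : injective (@theta _ _ H X V W).
Proof. exact: can_inj (@thetaK _ _ H X V W). Qed.

Lemma theta_comp X X' (V W : full_sub P) (phi : Hom X (bifun0 (ihom H) V W))
  (x : Hom X' X) : theta H (phi ∘ x) = theta H phi ∘ (x ⊠ idm (incl V)).
Proof. by rewrite !thetaE -compA -tensM comp1m. Qed.

Lemma ev_end_mul V : ev V V ∘ (end_mul V ⊠ idm (incl V)) =
  ev V V ∘ (idm (end_ob V) ⊠ ev V V) ∘ asc _ _ _.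
Proof. by rewrite -thetaE thetaVK. Qed.

Lemma ev_end_one V : ev V V ∘ (end_one V ⊠ idm (incl V)) = lun (incl V).
Proof. by rewrite -thetaE thetaVK. Qed.

Lemma end_mulA V : end_mul V ∘ (end_mul V ⊠ idm (end_ob V)) =
  end_mul V ∘ (idm (end_ob V) ⊠ end_mul V) ∘ asc _ _ _.
Proof.
apply: theta_inj; rewrite !theta_comp thetaE.
exact/assoc_of_ev/ev_end_mul.
Qed.

Lemma end_mul1l V : end_mul V ∘ (end_one V ⊠ idm (end_ob V)) = lun (end_ob V).
Proof.
apply: theta_inj; rewrite !theta_comp [RHS]thetaE thetaE ev_end_mul -!compA.
rewrite asc_nat tens1 (compA (idm _ ⊠ _)) -tensM comp1m compm1.
rewrite -[X in X ⊠ ev V V]compm1 -[X in _ ⊠ X]comp1m tensM !compA ev_end_one.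
by rewrite lun_nat -!compA lun_asc.
Qed.

Lemma end_mul1r V : end_mul V ∘ (idm (end_ob V) ⊠ end_one V) = run (end_ob V).
Proof.
apply: theta_inj; rewrite !theta_comp [RHS]thetaE thetaE ev_end_mul -!compA.
rewrite asc_nat (compA (idm _ ⊠ _)) -tensM comp1m ev_end_one.
by rewrite run_asc.
Qed.

Definition end_monoid (V : full_sub P) : monoid C :=
  Monoid (end_mulA V) (end_mul1l V) (end_mul1r V).

End Closed.

Section Coclosed.
Variables (C : strict_monoidal) (P : C -> Prop) (H : rel_coclosed P).

Definition coev (V W : full_sub P) :
    Hom (incl W) (bifun0 (cohom H) V W ⊗ incl V) :=
  vtheta H (idm (bifun0 (cohom H) V W)).

Definition coend_ob (V : full_sub P) : C := bifun0 (cohom H) V V.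

Definition coend_mul (V : full_sub P) :
    Hom (coend_ob V) (coend_ob V ⊗ coend_ob V) :=
  vthetaV H (ascV _ _ _ ∘ (idm (coend_ob V) ⊠ coev V V) ∘ coev V V).

Definition coend_one (V : full_sub P) : Hom (coend_ob V) munit :=
  vthetaV H (lunV (incl V)).

Lemma vthetaE (V W : full_sub P) Z (phi : Hom (bifun0 (cohom H) V W) Z) :
  vtheta H phi = (phi ⊠ idm (incl V)) ∘ coev V W.
Proof.
have E : bifun1 (cohom H) (idm V) (idm W) = idm _ by exact: fmap1.
have : vtheta H (phi ∘ idm _ ∘ bifun1 (cohom H) (idm V) (idm W)) =
    (phi ⊠ idm (incl V)) ∘ coev V W ∘ idm (incl W) by exact: vtheta_nat.
by rewrite E !compm1.
Qed.

Lemma vtheta_inj (V W : full_sub P) Z : injective (@vtheta _ _ H W V Z).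
Proof. exact: can_inj (@vthetaK _ _ H W V Z). Qed.

Lemma vtheta_comp Z Z' (V W : full_sub P) (phi : Hom (bifun0 (cohom H) V W) Z)
  (z : Hom Z Z') : vtheta H (z ∘ phi) = (z ⊠ idm (incl V)) ∘ vtheta H phi.
Proof. by rewrite !vthetaE compA -tensM comp1m. Qed.

Lemma vtheta_id V W : vtheta H (idm (bifun0 (cohom H) V W)) = coev V W.
Proof. by []. Qed.

Lemma coev_coend_mul V : (coend_mul V ⊠ idm (incl V)) ∘ coev V V =
  ascV _ _ _ ∘ (idm (coend_ob V) ⊠ coev V V) ∘ coev V V.
Proof. by rewrite -vthetaE vthetaVK. Qed.

Lemma coev_coend_one V :
  (coend_one V ⊠ idm (incl V)) ∘ coev V V = lunV (incl V).
Proof. by rewrite -vthetaE vthetaVK. Qed.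

Lemma coend_mulA V :
  asc _ _ _ ∘ (coend_mul V ⊠ idm (coend_ob V)) ∘ coend_mul V =
  (idm (coend_ob V) ⊠ coend_mul V) ∘ coend_mul V.
Proof.
suff dA : (coend_mul V ⊠ idm (coend_ob V)) ∘ coend_mul V =
    ascV _ _ _ ∘ ((idm (coend_ob V) ⊠ coend_mul V) ∘ coend_mul V).
  by rewrite -compA dA compA ascVK comp1m.
apply: vtheta_inj; rewrite !vtheta_comp vthetaE.
exact/coassoc_of_coev/coev_coend_mul.
Qed.

Lemma coend_mul1l V : lun (coend_ob V) ∘ (coend_one V ⊠ idm (coend_ob V))
  ∘ coend_mul V = idm (coend_ob V).
Proof.
apply: vtheta_inj; rewrite -compA !vtheta_comp vthetaE vtheta_id.
exact: (counitl_of_coev (coev_coend_mul V) (coev_coend_one V)).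
Qed.

Lemma coend_mul1r V : run (coend_ob V) ∘ (idm (coend_ob V) ⊠ coend_one V)
  ∘ coend_mul V = idm (coend_ob V).
Proof.
apply: vtheta_inj; rewrite -compA !vtheta_comp vthetaE vtheta_id.
exact: (counitr_of_coev (coev_coend_mul V) (coev_coend_one V)).
Qed.

Definition coend_comonoid (V : full_sub P) : comonoid C :=
  Comonoid (coend_mulA V) (coend_mul1l V) (coend_mul1r V).

End Coclosed.

Lemma sub_eq (T : Type) (Q : T -> Prop) (x y : {z : T | Q z}) :
  proj1_sig x = proj1_sig y -> x = y.
Proof. by case: x y => x Qx [y Qy] /= E; exact: subset_eq_compat. Qed.

Section Representations.
Variables (C : strict_monoidal) (P : C -> Prop) (H : rel_closed P).
Variable M : monoid C.

Record rep := Rep {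
  rep_ob :> full_sub P;
  rep_mor : Hom M (end_ob H rep_ob);
  rep_ax : is_monoid_mor (M := M) (N := end_monoid H rep_ob) rep_mor
}.

Definition is_rep_mor (R S : rep) (f : Hom (rep_ob R) (rep_ob S)) : Prop :=
  bifun1 (ihom H) (idm (rep_ob R)) f ∘ rep_mor R =
  bifun1 (ihom H) f (idm (rep_ob S)) ∘ rep_mor S.

Lemma is_rep_mor1 R : is_rep_mor (idm (rep_ob R)).
Proof. by []. Qed.

Lemma is_rep_morM (R S T : rep) (g : Hom (rep_ob S) (rep_ob T))
    (f : Hom (rep_ob R) (rep_ob S)) :
  is_rep_mor g -> is_rep_mor f -> is_rep_mor (R := R) (S := T) (g ∘ f).
Proof.
rewrite /is_rep_mor => gP fP.
by rewrite bifunMr -compA fP compA bifunC -compA gP compA -bifunMl.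
Qed.

Program Definition rep_cat : category :=
  @Category rep
    (fun R S => {f : Hom (rep_ob R) (rep_ob S) | is_rep_mor f})
    (fun R => exist _ (idm (rep_ob R)) (is_rep_mor1 R))
    (fun R S T g f => exist _ (proj1_sig g ∘ proj1_sig f)
       (is_rep_morM (proj2_sig g) (proj2_sig f))) _ _ _.
Next Obligation. by move=> R S f; apply: sub_eq; exact: comp1m. Qed.
Next Obligation. by move=> R S f; apply: sub_eq; exact: compm1. Qed.
Next Obligation. by move=> R S T U h g f; apply: sub_eq; exact: compA. Qed.

End Representations.

Section LeftActions.
Variables (C : strict_monoidal) (M : monoid C).

Definition is_lact (V : C) (a : Hom (M ⊗ V) V) : Prop :=
  a ∘ (mon_mul M ⊠ idm V) = a ∘ (idm M ⊠ a) ∘ asc M M V /\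
  a ∘ (mon_one M ⊠ idm V) = lun V.

Record lact := Lact {
  lact_ob :> C;
  lact_mor : Hom (M ⊗ lact_ob) lact_ob;
  lact_ax : is_lact lact_mor
}.

Definition is_lact_mor (V W : C) (a : Hom (M ⊗ V) V) (b : Hom (M ⊗ W) W)
    (f : Hom V W) : Prop :=
  f ∘ a = b ∘ (idm M ⊠ f).

Lemma is_lact_mor1 (V : lact) : is_lact_mor (lact_mor V) (lact_mor V) (idm V).
Proof. by rewrite /is_lact_mor tens1 comp1m compm1. Qed.

Lemma is_lact_morM (V W Z : lact) (g : Hom W Z) (f : Hom V W) :
  is_lact_mor (lact_mor W) (lact_mor Z) g ->
  is_lact_mor (lact_mor V) (lact_mor W) f ->
  is_lact_mor (lact_mor V) (lact_mor Z) (g ∘ f).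
Proof.
by rewrite /is_lact_mor => gP fP; rewrite -compA fP compA gP -compA tens1M.
Qed.

Program Definition lact_cat : category :=
  @Category lact
    (fun V W =>
       {f : Hom (lact_ob V) (lact_ob W) |
         is_lact_mor (lact_mor V) (lact_mor W) f})
    (fun V => exist _ (idm (lact_ob V)) (is_lact_mor1 V))
    (fun V W Z g f => exist _ (proj1_sig g ∘ proj1_sig f)
       (is_lact_morM (proj2_sig g) (proj2_sig f))) _ _ _.
Next Obligation. by move=> V W f; apply: sub_eq; exact: comp1m. Qed.
Next Obligation. by move=> V W f; apply: sub_eq; exact: compm1. Qed.
Next Obligation. by move=> V W Z T h g f; apply: sub_eq; exact: compA. Qed.

End LeftActions.

Section Corepresentations.
Variables (C : strict_monoidal) (P : C -> Prop) (H : rel_coclosed P).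
Variable O : comonoid C.

Record corep := Corep {
  corep_ob :> full_sub P;
  corep_mor : Hom (coend_ob H corep_ob) O;
  corep_ax : is_comonoid_mor (M := coend_comonoid H corep_ob) (N := O) corep_mor
}.

Definition is_corep_mor (R S : corep) (f : Hom (corep_ob R) (corep_ob S)) :
    Prop :=
  corep_mor R ∘ bifun1 (cohom H) f (idm (corep_ob R)) =
  corep_mor S ∘ bifun1 (cohom H) (idm (corep_ob S)) f.

Lemma is_corep_mor1 R : is_corep_mor (idm (corep_ob R)).
Proof. by []. Qed.

Lemma is_corep_morM (R S T : corep) (g : Hom (corep_ob S) (corep_ob T))
    (f : Hom (corep_ob R) (corep_ob S)) :
  is_corep_mor g -> is_corep_mor f -> is_corep_mor (R := R) (S := T) (g ∘ f).
Proof.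
rewrite /is_corep_mor => gP fP.
by rewrite bifunMl compA fP -compA bifunC compA gP -compA -bifunMr.
Qed.

Program Definition corep_cat : category :=
  @Category corep
    (fun R S => {f : Hom (corep_ob R) (corep_ob S) | is_corep_mor f})
    (fun R => exist _ (idm (corep_ob R)) (is_corep_mor1 R))
    (fun R S T g f => exist _ (proj1_sig g ∘ proj1_sig f)
       (is_corep_morM (proj2_sig g) (proj2_sig f))) _ _ _.
Next Obligation. by move=> R S f; apply: sub_eq; exact: comp1m. Qed.
Next Obligation. by move=> R S f; apply: sub_eq; exact: compm1. Qed.
Next Obligation. by move=> R S T U h g f; apply: sub_eq; exact: compA. Qed.

End Corepresentations.

Section LeftCoactions.
Variables (C : strict_monoidal) (O : comonoid C).

Definition is_lcoact (V : C) (d : Hom V (O ⊗ V)) : Prop :=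
  asc O O V ∘ (com_mul O ⊠ idm V) ∘ d = (idm O ⊠ d) ∘ d /\
  lun V ∘ (com_one O ⊠ idm V) ∘ d = idm V.

Record lcoact := Lcoact {
  lcoact_ob :> C;
  lcoact_mor : Hom lcoact_ob (O ⊗ lcoact_ob);
  lcoact_ax : is_lcoact lcoact_mor
}.

Definition is_lcoact_mor (V W : C) (d : Hom V (O ⊗ V)) (e : Hom W (O ⊗ W))
    (f : Hom V W) : Prop :=
  e ∘ f = (idm O ⊠ f) ∘ d.

Lemma is_lcoact_mor1 (V : lcoact) :
  is_lcoact_mor (lcoact_mor V) (lcoact_mor V) (idm V).
Proof. by rewrite /is_lcoact_mor tens1 comp1m compm1. Qed.

Lemma is_lcoact_morM (V W Z : lcoact) (g : Hom W Z) (f : Hom V W) :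
  is_lcoact_mor (lcoact_mor W) (lcoact_mor Z) g ->
  is_lcoact_mor (lcoact_mor V) (lcoact_mor W) f ->
  is_lcoact_mor (lcoact_mor V) (lcoact_mor Z) (g ∘ f).
Proof.
by rewrite /is_lcoact_mor => gP fP; rewrite compA gP -compA fP compA tens1M.
Qed.

Program Definition lcoact_cat : category :=
  @Category lcoact
    (fun V W =>
       {f : Hom (lcoact_ob V) (lcoact_ob W) |
         is_lcoact_mor (lcoact_mor V) (lcoact_mor W) f})
    (fun V => exist _ (idm (lcoact_ob V)) (is_lcoact_mor1 V))
    (fun V W Z g f => exist _ (proj1_sig g ∘ proj1_sig f)
       (is_lcoact_morM (proj2_sig g) (proj2_sig f))) _ _ _.
Next Obligation. by move=> V W f; apply: sub_eq; exact: comp1m. Qed.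
Next Obligation. by move=> V W f; apply: sub_eq; exact: compm1. Qed.
Next Obligation. by move=> V W Z T h g f; apply: sub_eq; exact: compA. Qed.

End LeftCoactions.

(* The assignments (V, rho) |-> (V, theta rho), f |-> f and
   (V, omega) |-> (V, vtheta omega), f |-> f, as functors.  That they are well
   defined is taken as an argument. *)
Program Definition rep_to_lact (C : strict_monoidal) (P : C -> Prop)
    (H : rel_closed P) (M : monoid C)
    (act : forall R : rep H M, is_lact (theta H (rep_mor R)))
    (act_mor : forall (R S : rep H M) (f : Hom (rep_ob R) (rep_ob S)),
       is_rep_mor f ->
       is_lact_mor (theta H (rep_mor R)) (theta H (rep_mor S)) f) :
    functor (rep_cat H M) (lact_cat M) :=
  @Functor (rep_cat H M) (lact_cat M)
    (fun R => Lact (act R))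
    (fun R S f => exist _ (proj1_sig f) (act_mor R S (proj1_sig f) (proj2_sig f)))
    _ _.
Next Obligation. by move=> *; exact: sub_eq. Qed.
Next Obligation. by move=> *; exact: sub_eq. Qed.

Program Definition corep_to_lcoact (C : strict_monoidal) (P : C -> Prop)
    (H : rel_coclosed P) (O : comonoid C)
    (coact : forall R : corep H O, is_lcoact (vtheta H (corep_mor R)))
    (coact_mor : forall (R S : corep H O) (f : Hom (corep_ob R) (corep_ob S)),
       is_corep_mor f ->
       is_lcoact_mor (vtheta H (corep_mor R)) (vtheta H (corep_mor S)) f) :
    functor (corep_cat H O) (lcoact_cat O) :=
  @Functor (corep_cat H O) (lcoact_cat O)
    (fun R => Lcoact (coact R))
    (fun R S f =>
       exist _ (proj1_sig f) (coact_mor R S (proj1_sig f) (proj2_sig f)))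
    _ _.
Next Obligation. by move=> *; exact: sub_eq. Qed.
Next Obligation. by move=> *; exact: sub_eq. Qed.

(* Main.v *)
From Corelib Require Import ssreflect ssrfun.
From Stdlib Require Import ProofIrrelevance FunctionalExtensionality.
Require Import Defs.

Open Scope cat_scope.

(** Under [theta], precomposing with [x] becomes precomposing with [x ⊠ id],
    and evaluation turns [end_mul] into iterated evaluation; hence the two
    equations saying that [rho] is a morphism of monoids are carried by the
    bijection [theta] to the two axioms of an action ([rep_iff_lact]). Likewise
    naturality of [theta] in [W], respectively in [V], carries the two sides of
    the equation defining a morphism of representations to the two sides of the
    one defining a morphism of actions ([rep_mor_iff_lact_mor]). So the functor
    is the identity on the underlying morphisms, between equal sets of
    morphisms, which is full faithfulness. The coclosed case is dual
    ([corep_iff_lcoact], [corep_mor_iff_lcoact_mor]).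

    When every object lies in [P], [(V, a) |-> (V, thetaV a)] is a two-sided
    inverse on objects, and a fully faithful functor that is bijective on objects
    is an isomorphism of categories ([iso_of_ff_bij_ob]). The equality of
    functors which this requires is obtained from [functor_ext], where the
    components of the functors on morphisms are compared along the morphisms
    [eqmor] given by equalities of objects; an isomorphism is then an equivalence
    since equal functors are naturally isomorphic. *)

(** * Isomorphisms of categories *)

Lemma eqmorK (C : category) (A B : C) (e : A = B) :
  eqmor (eq_sym e) ∘ eqmor e = idm A.
Proof. by case: _ / e; rewrite /= comp1m. Qed.

Lemma eqmorVK (C : category) (A B : C) (e : A = B) :
  eqmor e ∘ eqmor (eq_sym e) = idm B.
Proof. by case: _ / e; rewrite /= comp1m. Qed.

Lemma fmap_eqmor (C D : category) (F : functor C D) (A B : C) (e : A = B)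
    (e' : F A = F B) :
  fmap F (eqmor e) = eqmor e'.
Proof. by case: B / e e' => e'; rewrite fmap1 (proof_irrelevance _ e' eq_refl). Qed.

(** Extensionality of functors: the values on objects agree, and the values on
    morphisms agree along these equalities. *)
Lemma functor_ext (C D : category) (F G : functor C D)
    (e : forall A : C, F A = G A) :
  (forall (A B : C) (f : Hom A B),
     eqmor (e B) ∘ fmap F f = fmap G f ∘ eqmor (e A)) ->
  F = G.
Proof.
case: F G e => [F0 F1 F1_id F1_M] [G0 G1 G1_id G1_M] /= e eF.
have E0 : F0 = G0 by apply: functional_extensionality.
subst G0.
have E1 : F1 = G1.
  apply: functional_extensionality_dep => A.
  apply: functional_extensionality_dep => B.
  apply: functional_extensionality => f.
  have := eF A B f.
  rewrite (proof_irrelevance _ (e A) eq_refl) (proof_irrelevance _ (e B) eq_refl).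
  by rewrite /= comp1m compm1.
subst G1.
by rewrite (proof_irrelevance _ F1_id G1_id) (proof_irrelevance _ F1_M G1_M).
Qed.

Lemma naturally_isomorphic_refl (C D : category) (F : functor C D) :
  naturally_isomorphic F F.
Proof.
exists (fun A => idm (F A)), (fun A => idm (F A)).
by split=> *; rewrite ?comp1m ?compm1.
Qed.

Lemma equivalence_of_isomorphism (C D : category) (F : functor C D) :
  is_isomorphism F -> is_equivalence F.
Proof.
move=> [G [GF FG]]; exists G.
by rewrite GF FG; split; exact: naturally_isomorphic_refl.
Qed.

Section IsoOfFullyFaithful.
Variables (C D : category) (F : functor C D).
Variable Finv : forall A B : C, Hom (F A) (F B) -> Hom A B.
Hypothesis FinvK : forall (A B : C) (f : Hom A B), Finv A B (fmap F f) = f.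
Hypothesis FinvVK :
  forall (A B : C) (g : Hom (F A) (F B)), fmap F (Finv A B g) = g.
Variable G0 : D -> C.
Hypothesis FG0 : forall B : D, F (G0 B) = B.
Hypothesis G0F : forall A : C, G0 (F A) = A.

Lemma fully_faithful_of_inv : fully_faithful F.
Proof. by move=> A B; exists (Finv A B). Qed.

(** The inverse functor on morphisms: conjugate by the equalities
    [F (G0 A) = A], then take the preimage under [F]. *)
Let G1 (A B : D) (f : Hom A B) : Hom (G0 A) (G0 B) :=
  Finv _ _ (eqmor (eq_sym (FG0 B)) ∘ f ∘ eqmor (FG0 A)).

Let G1_id (A : D) : G1 A A (idm A) = idm (G0 A).
Proof. by rewrite /G1 compm1 eqmorK -(fmap1 F) FinvK. Qed.

Let G1_M (A B E : D) (g : Hom B E) (f : Hom A B) :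
  G1 A E (g ∘ f) = G1 B E g ∘ G1 A B f.
Proof.
rewrite -[RHS]FinvK fmapM /G1 !FinvVK; congr Finv.
by rewrite -!compA (compA (eqmor (FG0 B))) eqmorVK comp1m.
Qed.

(** A fully faithful functor, with explicit inverses on the sets of morphisms,
    and bijective on objects is an isomorphism of categories. *)
Lemma iso_of_ff_bij_ob : is_isomorphism F /\ is_equivalence F.
Proof.
suff iF : is_isomorphism F by split=> //; exact: equivalence_of_isomorphism.
pose G := @Functor D C G0 G1 G1_id G1_M; exists G; split.
- apply: (functor_ext _ _ (comp_functor G F) (id_functor C) G0F) => A B f /=.
  rewrite -[LHS]FinvK -[RHS]FinvK; congr Finv.
  rewrite !fmapM /G1 FinvVK (fmap_eqmor _ _ F _ _ _ (FG0 (F B))).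
  rewrite (fmap_eqmor _ _ F _ _ _ (FG0 (F A))).
  by rewrite !compA eqmorVK comp1m.
- apply: (functor_ext _ _ (comp_functor F G) (id_functor D) FG0) => A B f /=.
  by rewrite /G1 FinvVK !compA eqmorVK comp1m.
Qed.

End IsoOfFullyFaithful.

(** * Representations and actions *)

Section RepLact.
Variables (C : strict_monoidal) (P : C -> Prop) (H : rel_closed P).
Variable M : monoid C.

Lemma theta_end_mul (V : full_sub P) X (rho : Hom X (end_ob H V)) :
  theta H (end_mul H V ∘ (rho ⊠ rho)) =
  theta H rho ∘ (idm X ⊠ theta H rho) ∘ asc X X (incl V).
Proof.
rewrite theta_comp thetaE ev_end_mul -!compA asc_nat.
rewrite (compA (idm _ ⊠ _)) -tensM comp1m -thetaE tens_lr !compA.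
by rewrite -thetaE.
Qed.

Lemma theta_end_one (V : full_sub P) : theta H (end_one H V) = lun (incl V).
Proof. by rewrite thetaVK. Qed.

Lemma rep_iff_lact (V : full_sub P) (rho : Hom M (end_ob H V)) :
  is_monoid_mor (M := M) (N := end_monoid H V) rho <-> is_lact (theta H rho).
Proof.
rewrite /is_monoid_mor /is_lact /= -theta_end_mul -theta_end_one -!theta_comp.
by split=> [[-> ->]|[/theta_inj -> /theta_inj ->]].
Qed.

Lemma theta_ihom_r X (V W W' : full_sub P) (w : Hom W W')
    (phi : Hom X (bifun0 (ihom H) V W)) :
  theta H (bifun1 (ihom H) (idm V) w ∘ phi) =
  (w : Hom (incl W) (incl W')) ∘ theta H phi.
Proof. by rewrite -[X in theta H X]compm1 theta_nat tens1 compm1. Qed.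

Lemma theta_ihom_l X (V V' W : full_sub P) (v : Hom V' V)
    (phi : Hom X (bifun0 (ihom H) V W)) :
  theta H (bifun1 (ihom H) v (idm W) ∘ phi) =
  theta H phi ∘ (idm X ⊠ (v : Hom (incl V') (incl V))).
Proof. by rewrite -[X in theta H X]compm1 theta_nat comp1m. Qed.

Lemma rep_mor_iff_lact_mor (R S : rep H M) (f : Hom (rep_ob R) (rep_ob S)) :
  is_rep_mor f <->
  is_lact_mor (theta H (rep_mor R)) (theta H (rep_mor S)) f.
Proof.
rewrite /is_rep_mor /is_lact_mor -theta_ihom_r -theta_ihom_l.
by split=> [->|/theta_inj].
Qed.

Lemma lact_eq (V : C) (a b : Hom (M ⊗ V) V) (aP : is_lact a) (bP : is_lact b) :
  a = b -> Lact aP = Lact bP.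
Proof. by move=> E; subst b; rewrite (proof_irrelevance _ aP bP). Qed.

Lemma rep_eq (V : full_sub P) (r s : Hom M (end_ob H V))
    (rP : is_monoid_mor (M := M) (N := end_monoid H V) r)
    (sP : is_monoid_mor (M := M) (N := end_monoid H V) s) :
  r = s -> Rep rP = Rep sP.
Proof. by move=> E; subst s; rewrite (proof_irrelevance _ rP sP). Qed.

Variables (act : forall R : rep H M, is_lact (theta H (rep_mor R)))
  (act_mor : forall (R S : rep H M) (f : Hom (rep_ob R) (rep_ob S)),
     is_rep_mor f ->
     is_lact_mor (theta H (rep_mor R)) (theta H (rep_mor S)) f).
Let F := rep_to_lact act act_mor.

Let Finv (R S : rep_cat H M) (g : Hom (F R) (F S)) : Hom R S :=
  exist _ (proj1_sig g) (proj2 (rep_mor_iff_lact_mor R S _) (proj2_sig g)).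

Lemma rep_to_lact_ff : fully_faithful F.
Proof. by apply: (fully_faithful_of_inv _ _ F Finv) => *; exact: sub_eq. Qed.

Lemma rep_to_lact_iso :
  (forall V : C, P V) -> is_isomorphism F /\ is_equivalence F.
Proof.
move=> allP; pose obP (V : C) : full_sub P := exist P V (allP V).
have G0P (A : lact M) : is_monoid_mor (M := M) (N := end_monoid H (obP A))
    (@thetaV _ _ H M (obP A) (obP A) (lact_mor A)).
  by apply/rep_iff_lact; rewrite thetaVK; exact: (lact_ax A).
apply: (iso_of_ff_bij_ob _ _ F Finv _ _ (fun A => Rep (G0P A))).
- by move=> *; exact: sub_eq.
- by move=> *; exact: sub_eq.
- by case=> V a aP; apply: lact_eq; exact: thetaVK.
- case=> [[V pV] r rP].
  (* The proof that V is in P is replaced by the one chosen in [obP]. *)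
  have E : pV = allP V by exact: proof_irrelevance.
  by subst pV; apply: rep_eq; exact: thetaK.
Qed.

End RepLact.

(** * Corepresentations and coactions *)

Section CorepLcoact.
Variables (C : strict_monoidal) (P : C -> Prop) (H : rel_coclosed P).
Variable O : comonoid C.

Lemma vtheta_coend_mul (V : full_sub P) Z (om : Hom (coend_ob H V) Z) :
  vtheta H ((om ⊠ om) ∘ coend_mul H V) =
  ascV Z Z (incl V) ∘ (idm Z ⊠ vtheta H om) ∘ vtheta H om.
Proof.
rewrite vtheta_comp vthetaE coev_coend_mul !compA -ascV_nat.
rewrite -(compA (ascV _ _ _)) -tensM compm1 -vthetaE tens_rl -!compA.
by rewrite -vthetaE.
Qed.

Lemma vtheta_coend_one (V : full_sub P) :
  vtheta H (coend_one H V) = lunV (incl V).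
Proof. by rewrite vthetaVK. Qed.

Lemma corep_iff_lcoact (V : full_sub P) (om : Hom (coend_ob H V) O) :
  is_comonoid_mor (M := coend_comonoid H V) (N := O) om <->
  is_lcoact (vtheta H om).
Proof.
rewrite /is_comonoid_mor /is_lcoact /= -!compA -!vtheta_comp.
split=> [[-> ->]|[mP oP]].
  by rewrite vtheta_coend_mul vtheta_coend_one !compA ascVK comp1m lunVK.
split; apply: (vtheta_inj (H := H)).
  by rewrite vtheta_coend_mul -compA -mP !compA ascK comp1m.
by rewrite vtheta_coend_one -[RHS]compm1 -oP compA lunK comp1m.
Qed.

Lemma vtheta_cohom_r Z (V W W' : full_sub P) (w : Hom W' W)
    (phi : Hom (bifun0 (cohom H) V W) Z) :
  vtheta H (phi ∘ bifun1 (cohom H) (idm V) w) =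
  vtheta H phi ∘ (w : Hom (incl W') (incl W)).
Proof. by rewrite -[phi in LHS]comp1m vtheta_nat tens1 comp1m. Qed.

Lemma vtheta_cohom_l Z (V V' W : full_sub P) (v : Hom V V')
    (phi : Hom (bifun0 (cohom H) V W) Z) :
  vtheta H (phi ∘ bifun1 (cohom H) v (idm W)) =
  (idm Z ⊠ (v : Hom (incl V) (incl V'))) ∘ vtheta H phi.
Proof. by rewrite -[phi in LHS]comp1m vtheta_nat compm1. Qed.

Lemma corep_mor_iff_lcoact_mor (R S : corep H O)
    (f : Hom (corep_ob R) (corep_ob S)) :
  is_corep_mor f <->
  is_lcoact_mor (vtheta H (corep_mor R)) (vtheta H (corep_mor S)) f.
Proof.
rewrite /is_corep_mor /is_lcoact_mor -vtheta_cohom_r -vtheta_cohom_l.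
by split=> [->|/vtheta_inj ->].
Qed.

Lemma lcoact_eq (V : C) (a b : Hom V (O ⊗ V)) (aP : is_lcoact a)
    (bP : is_lcoact b) :
  a = b -> Lcoact aP = Lcoact bP.
Proof. by move=> E; subst b; rewrite (proof_irrelevance _ aP bP). Qed.

Lemma corep_eq (V : full_sub P) (r s : Hom (coend_ob H V) O)
    (rP : is_comonoid_mor (M := coend_comonoid H V) (N := O) r)
    (sP : is_comonoid_mor (M := coend_comonoid H V) (N := O) s) :
  r = s -> Corep rP = Corep sP.
Proof. by move=> E; subst s; rewrite (proof_irrelevance _ rP sP). Qed.

Variables (coact : forall R : corep H O, is_lcoact (vtheta H (corep_mor R)))
  (coact_mor : forall (R S : corep H O) (f : Hom (corep_ob R) (corep_ob S)),
     is_corep_mor f ->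
     is_lcoact_mor (vtheta H (corep_mor R)) (vtheta H (corep_mor S)) f).
Let F := corep_to_lcoact coact coact_mor.

Let Finv (R S : corep_cat H O) (g : Hom (F R) (F S)) : Hom R S :=
  exist _ (proj1_sig g) (proj2 (corep_mor_iff_lcoact_mor R S _) (proj2_sig g)).

Lemma corep_to_lcoact_ff : fully_faithful F.
Proof. by apply: (fully_faithful_of_inv _ _ F Finv) => *; exact: sub_eq. Qed.

Lemma corep_to_lcoact_iso :
  (forall V : C, P V) -> is_isomorphism F /\ is_equivalence F.
Proof.
move=> allP; pose obP (V : C) : full_sub P := exist P V (allP V).
have G0P (A : lcoact O) : is_comonoid_mor (M := coend_comonoid H (obP A))
    (N := O) (@vthetaV _ _ H (obP A) (obP A) O (lcoact_mor A)).
  by apply/corep_iff_lcoact; rewrite vthetaVK; exact: (lcoact_ax A).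
apply: (iso_of_ff_bij_ob _ _ F Finv _ _ (fun A => Corep (G0P A))).
- by move=> *; exact: sub_eq.
- by move=> *; exact: sub_eq.
- by case=> V a aP; apply: lcoact_eq; exact: vthetaVK.
- case=> [[V pV] r rP].
  (* The proof that V is in P is replaced by the one chosen in [obP]. *)
  have E : pV = allP V by exact: proof_irrelevance.
  by subst pV; apply: corep_eq; exact: vthetaK.
Qed.

End CorepLcoact.

(** * Representations as actions, corepresentations as coactions *)

Theorem theorem3p5 (C : symmetric_monoidal) (P : C -> Prop) :
  (forall (H : rel_closed P) (M : monoid C),
    (forall (V : full_sub P) (rho : Hom M (end_ob H V)),
       is_monoid_mor (M := M) (N := end_monoid H V) rho <->
       is_lact (theta H rho)) /\
    (forall (V : full_sub P) (a : Hom (M ⊗ incl V) (incl V)),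
       is_lact a ->
       exists! rho : Hom M (end_ob H V),
         is_monoid_mor (M := M) (N := end_monoid H V) rho /\
         theta H rho = a) /\
    (forall (R S : rep H M) (f : Hom (rep_ob R) (rep_ob S)),
       is_rep_mor f <->
       is_lact_mor (theta H (rep_mor R)) (theta H (rep_mor S)) f) /\
    (exists act act_mor,
       let F := @rep_to_lact C P H M act act_mor in
       fully_faithful F /\
       ((forall V : C, P V) -> is_isomorphism F /\ is_equivalence F))) /\
  (forall (H : rel_coclosed P) (O : comonoid C),
    exists coact coact_mor,
      let F := @corep_to_lcoact C P H O coact coact_mor in
      fully_faithful F /\
      ((forall V : C, P V) -> is_isomorphism F /\ is_equivalence F)).
Proof.
split=> [H M|H O].
  split; first exact: rep_iff_lact.
  split.
    move=> V a aP; exists (thetaV H a).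
    split=> [|r [_ <-]]; last by rewrite thetaK.
    by split; [apply/rep_iff_lact; rewrite thetaVK | exact: thetaVK].
  split; first exact: rep_mor_iff_lact_mor.
  exists (fun R => proj1 (rep_iff_lact _ _ H M _ _) (rep_ax R)).
  exists (fun R S f => proj1 (rep_mor_iff_lact_mor _ _ H M R S f)).
  by split; [exact: rep_to_lact_ff | exact: rep_to_lact_iso].
exists (fun R => proj1 (corep_iff_lcoact _ _ H O _ _) (corep_ax R)).
exists (fun R S f => proj1 (corep_mor_iff_lcoact_mor _ _ H O R S f)).
by split; [exact: corep_to_lcoact_ff | exact: corep_to_lcoact_iso].
Qed.
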